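(* Let $ABCDEF$ be an ideal hexagon in the hyperbolic plane. Let $l_1$ be the common perpendicular to the lines $AB$ and $DE$, let $l_2$ be the common perpendicular to the lines $BC$ and $EF$, and let $l_3$ be the common perpendicular to the lines $CD$ and $FA$. Then $l_1$, $l_2$ and $l_3$ are concurrent.
   Context: The hyperbolic plane is taken in the Klein model: an open disk $\Delta$ bounded by a circle $\Gamma$, with the Hilbert distance $d(P,Q)=\frac12\log\left(\frac{BP}{BQ}\cdot\frac{AQ}{AP}\right)$, where $A,B$ are the intersection points of the line $PQ$ with $\Gamma$. Geodesics (hyperbolic lines) are the intersections of straight lines with $\Delta$. Points of $\Gamma$ are called ideal points. For distinct ideal points $X,Y$, ''the line $XY$'' is the hyperbolic line with endpoints $X,Y$. An ideal hexagon $ABCDEF$ is one whose vertices $A,B,C,D,E,F$ are distinct ideal points occurring in this cyclic order on $\Gamma$. In particular opposite sides do not meet in $\Delta\cup\Gamma$, and two hyperbolic lines that do not meet in $\Delta\cup\Gamma$ have a unique common perpendicular, i.e. a unique hyperbolic line orthogonal to both. Orthogonality is in the sense of the hyperbolic metric. Lines are concurrent if they all pass through a common point of the hyperbolic plane. *)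

(* Defs.v *)
From Stdlib Require Import Reals Lra.
From Coquelicot Require Import Coquelicot.
Open Scope R_scope.

(* The Euclidean plane.  Throughout, c and r are the centre and the radius of
   the circle bounding the Klein model. *)
Definition point : Type := (R * R)%type.

Definition padd (P Q : point) : point := (fst P + fst Q, snd P + snd Q).
Definition psub (P Q : point) : point := (fst P - fst Q, snd P - snd Q).
Definition pscal (t : R) (P : point) : point := (t * fst P, t * snd P).
Definition pdot (P Q : point) : R := fst P * fst Q + snd P * snd Q.
Definition edist (P Q : point) : R := dist_euc (fst P) (snd P) (fst Q) (snd Q).

Definition in_disk (c : point) (r : R) (P : point) : Prop := edist P c < r.
Definition ideal (c : point) (r : R) (P : point) : Prop := edist P c = r.

(* Only meaningful for P <> Q.  When P and Q are ideal this is the hyperbolic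
   line with endpoints P and Q. *)
Definition chord (c : point) (r : R) (P Q : point) : point -> Prop :=
  fun Z => in_disk c r Z /\ exists t : R, Z = padd P (pscal t (psub Q P)).

Definition hline (c : point) (r : R) (l : point -> Prop) : Prop :=
  (exists Z, l Z) /\
  exists P Q : point, P <> Q /\ forall Z, l Z <-> chord c r P Q Z.

(* The point where the ray from P through Q leaves the disk: its parameter is
   the larger root t of |P + t (Q - P) - c|^2 = r^2. *)
Definition exit_point (c : point) (r : R) (P Q : point) : point :=
  let v := psub Q P in
  let w := psub P c in
  padd P (pscal
    ((- pdot w v + sqrt (pdot w v ^ 2 + pdot v v * (r ^ 2 - pdot w w)))
       / pdot v v) v).

(* The endpoints are labelled so that A, P, Q, B lie in this order, which makes
   the logarithm nonnegative.  For P = Q the totalised division and logarithm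
   give 0, see [hdist_refl]. *)
Definition hdist (c : point) (r : R) (P Q : point) : R :=
  let A := exit_point c r Q P in
  let B := exit_point c r P Q in
  / 2 * ln (edist B P / edist B Q * (edist A Q / edist A P)).

(* The Riemannian metric underlying [hdist]: the squared speed at t = 0 of
   t |-> P + t v, and the inner product obtained from it by polarisation. *)
Definition hnorm2 (c : point) (r : R) (P v : point) : R :=
  real (Lim (fun t => (hdist c r P (padd P (pscal t v)) / t) ^ 2) 0).

Definition hinner (c : point) (r : R) (P u v : point) : R :=
  (hnorm2 c r P (padd u v) - hnorm2 c r P (psub u v)) / 4.

Definition horthogonal (c : point) (r : R) (l m : point -> Prop) : Prop :=
  exists P, l P /\ m P /\
    forall X Y, l X -> m Y -> hinner c r P (psub X P) (psub Y P) = 0.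

Definition common_perpendicular (c : point) (r : R) (m m' l : point -> Prop)
  : Prop :=
  hline c r l /\ horthogonal c r l m /\ horthogonal c r l m'.

Definition circle_point (c : point) (r t : R) : point :=
  padd c (pscal r (cos t, sin t)).

Definition counterclockwise (c : point) (r : R) (A B C D E F : point) : Prop :=
  exists a b c' d e f : R,
    (a < b /\ b < c' /\ c' < d /\ d < e /\ e < f /\ f < a + 2 * PI) /\
    A = circle_point c r a /\ B = circle_point c r b /\
    C = circle_point c r c' /\ D = circle_point c r d /\
    E = circle_point c r e /\ F = circle_point c r f.

(* The cyclic order A, B, C, D, E, F may be met going round in either
   direction. *)
Definition ideal_hexagon (c : point) (r : R) (A B C D E F : point) : Prop :=
  counterclockwise c r A B C D E F \/ counterclockwise c r F E D C B A.

Lemma hdist_refl (c : point) (r : R) (P : point) : hdist c r P P = 0.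
Proof.
unfold hdist.
replace (edist (exit_point c r P P) P) with 0.
- rewrite Rdiv_0_l, Rmult_0_l; unfold ln.
  destruct (Rlt_dec 0 0) as [h | _]; [exfalso; lra | ring].
- unfold edist, exit_point, dist_euc, padd, pscal, psub; simpl.
  rewrite <- sqrt_0; f_equal; unfold Rsqr; ring.
Qed.

(* Main.v *)
(* In the Klein model a line is orthogonal to the chord AB exactly when it passes
   through the pole of AB.  Write the ideal point at angle t through the vector
   (cos (t/2), sin (t/2)): the pole of AB becomes the symmetric product of the
   vectors of A and B, so l1 is the cross product of the poles of AB and DE, and
   similarly for l2 and l3.  The determinant of these three cross products
   vanishes identically in the six vectors, hence a common point of l1 and l2
   lies on l3.  Such a point exists in the disk: l2 has a point on each of the
   chords BC and EF, l1 on each of AB and DE, and by the cyclic order of the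
   vertices the former two are strictly separated by l1. *)
Require Import Defs.
From Stdlib Require Import Reals Lra Psatz.
From Coquelicot Require Import Coquelicot.
Open Scope R_scope.

(** * Vectors of three-space and the determinant identity *)

Definition vec : Type := (R * R * R)%type.

Definition vdot (u v : vec) : R :=
  let '(u1, u2, u3) := u in let '(v1, v2, v3) := v in
  u1 * v1 + u2 * v2 + u3 * v3.

Definition vscal (k : R) (u : vec) : vec :=
  let '(u1, u2, u3) := u in (k * u1, k * u2, k * u3).

Definition cross (u v : vec) : vec :=
  let '(u1, u2, u3) := u in let '(v1, v2, v3) := v in
  (u2 * v3 - u3 * v2, u3 * v1 - u1 * v3, u1 * v2 - u2 * v1).

Definition bracket (p q : R * R) : R := fst p * snd q - snd p * fst q.

(** Coefficients of the product of the linear forms [p1 + p2 x] and [q1 + q2 x]; the middle one is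
    twice the off-diagonal entry of the symmetric matrix. *)
Definition sym (p q : R * R) : vec :=
  (fst p * fst q, fst p * snd q + snd p * fst q, snd p * snd q).

(** By the triple product expansion, [l] has zero cross product with [cross n n']; this is [Hxy],
    [Hyz], [Hzx]. Any nonzero coordinate of [cross n n'] then gives the ratio [k]. *)
Lemma orthogonal_cross (l n n' : vec) :
  vdot l n = 0 -> vdot l n' = 0 -> cross n n' <> (0, 0, 0) ->
  exists k, l = vscal k (cross n n').
Proof.
destruct l as [[l1 l2] l3], n as [[n1 n2] n3], n' as [[m1 m2] m3].
unfold vdot, vscal, cross; intros H H' Hn.
set (x := n2 * m3 - n3 * m2) in *; set (y := n3 * m1 - n1 * m3) in *;
  set (z := n1 * m2 - n2 * m1) in *.
assert (Hxy : l1 * y = l2 * x) by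
  (unfold x, y;
   transitivity (l2 * (n2 * m3 - n3 * m2)
     + n3 * (l1 * m1 + l2 * m2 + l3 * m3) - m3 * (l1 * n1 + l2 * n2 + l3 * n3));
   [ring | rewrite H, H'; ring]).
assert (Hyz : l2 * z = l3 * y) by
  (unfold y, z;
   transitivity (l3 * (n3 * m1 - n1 * m3)
     + n1 * (l1 * m1 + l2 * m2 + l3 * m3) - m1 * (l1 * n1 + l2 * n2 + l3 * n3));
   [ring | rewrite H, H'; ring]).
assert (Hzx : l3 * x = l1 * z) by
  (unfold x, z;
   transitivity (l1 * (n1 * m2 - n2 * m1)
     + n2 * (l1 * m1 + l2 * m2 + l3 * m3) - m2 * (l1 * n1 + l2 * n2 + l3 * n3));
   [ring | rewrite H, H'; ring]).
clearbody x y z.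
destruct (Req_dec x 0) as [-> | Hx].
- destruct (Req_dec y 0) as [-> | Hy].
  + destruct (Req_dec z 0) as [-> | Hz]; [now destruct Hn | exists (l3 / z)].
    repeat apply f_equal2; apply (Rmult_eq_reg_r z); trivial; field_simplify;
      trivial; lra.
  + exists (l2 / y).
    repeat apply f_equal2; apply (Rmult_eq_reg_r y); trivial; field_simplify;
      trivial; lra.
- exists (l1 / x).
  repeat apply f_equal2; apply (Rmult_eq_reg_r x); trivial; field_simplify;
    trivial; lra.
Qed.

(** Since [(z.u) v = (z.v) u + z × (v × u)], the hypotheses give [(z.u) v = 0]. *)
Lemma cross_eq0_vdot (u v z : vec) :
  cross u v = (0, 0, 0) -> v <> (0, 0, 0) -> vdot z v = 0 -> vdot z u = 0.
Proof.
destruct u as [[u1 u2] u3], v as [[v1 v2] v3], z as [[z1 z2] z3].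
unfold cross, vdot; intros H Hv Hz; injection H as H1 H2 H3.
destruct (Req_dec (z1 * u1 + z2 * u2 + z3 * u3) 0) as [| Hu]; trivial.
destruct Hv; f_equal; [f_equal |];
  apply (Rmult_eq_reg_r (z1 * u1 + z2 * u2 + z3 * u3)); trivial;
  rewrite Rmult_0_l.
- transitivity (u1 * (z1 * v1 + z2 * v2 + z3 * v3)
    - z2 * (u1 * v2 - u2 * v1) + z3 * (u3 * v1 - u1 * v3));
  [ring | rewrite H2, H3, Hz; ring].
- transitivity (u2 * (z1 * v1 + z2 * v2 + z3 * v3)
    + z1 * (u1 * v2 - u2 * v1) - z3 * (u2 * v3 - u3 * v2));
  [ring | rewrite H1, H3, Hz; ring].
- transitivity (u3 * (z1 * v1 + z2 * v2 + z3 * v3)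
    - z1 * (u3 * v1 - u1 * v3) + z2 * (u2 * v3 - u3 * v2));
  [ring | rewrite H1, H2, Hz; ring].
Qed.

(* The left-hand side is the resultant of the binary quadratic forms with roots
   [a], [b] and [d], [e]. *)
Lemma cross_sym_resultant (a b d e : R * R) :
  let '(m1, m2, m3) := cross (sym a b) (sym d e) in
  m2 ^ 2 - m1 * m3 = bracket a d * bracket a e * bracket b d * bracket b e.
Proof. unfold cross, sym, bracket; simpl; ring. Qed.

(** A zero cross product would make the resultant vanish, but it is a product of positive
    brackets. *)
Lemma cross_sym_neq0 (a b d e : R * R) :
  0 < bracket a d -> 0 < bracket a e -> 0 < bracket b d -> 0 < bracket b e ->
  cross (sym a b) (sym d e) <> (0, 0, 0).
Proof.
intros H1 H2 H3 H4 H.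
pose proof (cross_sym_resultant a b d e) as E; rewrite H in E.
assert (0 < bracket a d * bracket a e * bracket b d * bracket b e)
  by (repeat apply Rmult_lt_0_compat; assumption).
lra.
Qed.

(** Behind it is a linear dependence: writing [[p q]] for [bracket p q] and [pq] for [sym p q],
    [[c f] (ab × de) = [a d] (bc × ef) + [b e] (cd × fa)]. The determinant itself is expanded
    directly. *)
Lemma hexagon_identity (a b c d e f : R * R) :
  vdot (cross (cross (sym a b) (sym d e)) (cross (sym b c) (sym e f)))
       (cross (sym c d) (sym f a)) = 0.
Proof.
destruct a, b, c, d, e, f; unfold vdot, cross, sym; simpl.
ring.
Qed.

Lemma vdot_vscal_r (k : R) (u v : vec) : vdot u (vscal k v) = k * vdot u v.
Proof. destruct u as [[? ?] ?], v as [[? ?] ?]; simpl; ring. Qed.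

Lemma vdot_vscal_l (k : R) (u v : vec) : vdot (vscal k u) v = k * vdot u v.
Proof. destruct u as [[? ?] ?], v as [[? ?] ?]; simpl; ring. Qed.

Lemma cross_vscal (j k : R) (u v : vec) :
  cross (vscal j u) (vscal k v) = vscal (j * k) (cross u v).
Proof.
destruct u as [[? ?] ?], v as [[? ?] ?]; simpl.
f_equal; [f_equal |]; ring.
Qed.

(** Opposite sides have independent poles, so each [li] is a multiple of a cross product of poles
    and [z] one of [cross l1 l2]; [vdot z l3] is thus a multiple of the vanishing determinant. *)
Lemma hexagon_concurrent (a b c d e f : R * R) (l1 l2 l3 z : vec) :
  0 < bracket a c -> 0 < bracket a d -> 0 < bracket a e ->
  0 < bracket b d -> 0 < bracket b e -> 0 < bracket b f ->
  0 < bracket c e -> 0 < bracket c f -> 0 < bracket d f ->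
  vdot l1 (sym a b) = 0 -> vdot l1 (sym d e) = 0 ->
  vdot l2 (sym b c) = 0 -> vdot l2 (sym e f) = 0 ->
  vdot l3 (sym c d) = 0 -> vdot l3 (sym f a) = 0 ->
  cross l1 l2 <> (0, 0, 0) -> vdot z l1 = 0 -> vdot z l2 = 0 ->
  vdot z l3 = 0.
Proof.
intros ac ad ae bd be bf ce cf df H1 H1' H2 H2' H3 H3' Hl Hz1 Hz2.
destruct (orthogonal_cross _ _ _ Hz1 Hz2 Hl) as [k ->].
destruct (orthogonal_cross _ _ _ H1 H1') as [k1 ->];
  [now apply cross_sym_neq0 |].
destruct (orthogonal_cross _ _ _ H2 H2') as [k2 ->];
  [now apply cross_sym_neq0 |].
destruct (orthogonal_cross _ _ _ H3 H3') as [k3 ->].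
- intros H; pose proof (cross_sym_resultant c d f a) as E; rewrite H in E.
  assert (0 < bracket c f * bracket a c * bracket d f * bracket a d)
    by (repeat apply Rmult_lt_0_compat; assumption).
  (* The side [fa] closes the cycle, so two brackets come in reversed order; their signs cancel. *)
  assert (bracket c f * bracket c a * bracket d f * bracket d a
    = bracket c f * bracket a c * bracket d f * bracket a d)
    by (unfold bracket; ring).
  lra.
- rewrite cross_vscal, vdot_vscal_r, !vdot_vscal_l, hexagon_identity; ring.
Qed.

(** * The Hilbert distance along a Euclidean line *)

Lemma edist_sqr (P Q : point) :
  edist P Q = sqrt (pdot (psub P Q) (psub P Q)).
Proof. unfold edist, dist_euc, pdot, psub, Rsqr; simpl; f_equal; ring. Qed.

Lemma edist_line (P v : point) (s t : R) :
  edist (padd P (pscal s v)) (padd P (pscal t v))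
  = Rabs (s - t) * sqrt (pdot v v).
Proof.
rewrite edist_sqr, <- sqrt_Rsqr_abs, <- sqrt_mult_alt by apply Rle_0_sqr.
f_equal; unfold pdot, psub, padd, pscal, Rsqr; simpl; ring.
Qed.

Lemma in_disk_iff (c : point) (r : R) (P : point) : 0 < r ->
  in_disk c r P <-> pdot (psub P c) (psub P c) < r ^ 2.
Proof.
intros Hr; unfold in_disk; rewrite edist_sqr.
assert (Hp : 0 <= pdot (psub P c) (psub P c)) by
  (unfold pdot; nra).
rewrite <- (sqrt_pow2 r) at 1 by lra.
split; intros H.
- apply sqrt_lt_0_alt; exact H.
- apply sqrt_lt_1_alt; split; assumption.
Qed.

(** The parameter in [exit_point], taken for a fixed direction [v] so that it stays constant while
    the second point moves along the ray. *)
Definition exit_time (c : point) (r : R) (P v : point) : R :=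
  let w := psub P c in
  (- pdot w v + sqrt (pdot w v ^ 2 + pdot v v * (r ^ 2 - pdot w w)))
    / pdot v v.

Definition popp (v : point) : point := pscal (-1) v.

Lemma exit_point_ray (c : point) (r : R) (P v : point) (t : R) :
  0 < t -> 0 < pdot v v ->
  exit_point c r P (padd P (pscal t v)) = padd P (pscal (exit_time c r P v) v).
Proof.
intros Ht Hv; unfold exit_point, exit_time.
replace (psub (padd P (pscal t v)) P) with (pscal t v)
  by (destruct P, v; unfold psub, padd, pscal; simpl; f_equal; ring).
replace (pdot (psub P c) (pscal t v)) with (t * pdot (psub P c) v)
  by (unfold pdot, pscal; simpl; ring).
replace (pdot (pscal t v) (pscal t v)) with (t ^ 2 * pdot v v)
  by (unfold pdot, pscal; simpl; ring).
set (b := pdot (psub P c) v); set (a := pdot v v) in *.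
set (d := r ^ 2 - pdot (psub P c) (psub P c)).
replace ((t * b) ^ 2 + t ^ 2 * a * d) with (t ^ 2 * (b ^ 2 + a * d)) by ring.
rewrite sqrt_mult_alt, sqrt_pow2 by nra.
f_equal; unfold pscal; simpl; f_equal; field; lra.
Qed.

(** Going backwards, the start [P + t v] needs exactly [t] more time than [P] to reach the
    circle. *)
Lemma exit_point_ray_back (c : point) (r : R) (P v : point) (t : R) :
  0 < t -> 0 < pdot v v ->
  exit_point c r (padd P (pscal t v)) P
  = padd P (pscal (- exit_time c r P (popp v)) v).
Proof.
intros Ht Hv; set (Q := padd P (pscal t v)).
replace P with (padd Q (pscal t (popp v))) at 1
  by (destruct P, v; unfold Q, popp, padd, pscal; simpl; f_equal; ring).
rewrite exit_point_ray; trivial;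
  [| unfold popp, pdot, pscal in *; simpl; lra].
replace (exit_time c r Q (popp v)) with (t + exit_time c r P (popp v)).
- unfold Q, popp, padd, pscal; destruct P, v; simpl; f_equal; ring.
- unfold exit_time.
  replace (pdot (psub Q c) (popp v))
    with (pdot (psub P c) (popp v) - t * pdot v v)
    by (unfold Q, popp, pdot, psub, padd, pscal; simpl; ring).
  replace (pdot (psub Q c) (psub Q c)) with
    (pdot (psub P c) (psub P c) - 2 * t * pdot (psub P c) (popp v)
     + t ^ 2 * pdot v v)
    by (unfold Q, popp, pdot, psub, padd, pscal; simpl; ring).
  replace (pdot (popp v) (popp v)) with (pdot v v)
    by (unfold popp, pdot, pscal; simpl; ring).
  set (a := pdot v v) in *; set (b := pdot (psub P c) (popp v)).
  set (w2 := pdot (psub P c) (psub P c)).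
  replace ((b - t * a) ^ 2 + a * (r ^ 2 - (w2 - 2 * t * b + t ^ 2 * a)))
    with (b ^ 2 + a * (r ^ 2 - w2)) by ring.
  field; lra.
Qed.

(** The power of the point [P]: [exit_time] along [v] and minus [exit_time] along [-v] are the two
    roots of one quadratic equation. *)
Lemma exit_time_mult (c : point) (r : R) (P v : point) :
  0 < pdot v v -> pdot (psub P c) (psub P c) < r ^ 2 ->
  exit_time c r P v * exit_time c r P (popp v)
  = (r ^ 2 - pdot (psub P c) (psub P c)) / pdot v v.
Proof.
intros Hv HP; unfold exit_time.
replace (pdot (psub P c) (popp v)) with (- pdot (psub P c) v)
  by (unfold popp, pdot, pscal; simpl; ring).
replace (pdot (popp v) (popp v)) with (pdot v v)
  by (unfold popp, pdot, pscal; simpl; ring).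
set (a := pdot v v) in *; set (b := pdot (psub P c) v).
set (d := r ^ 2 - _).
assert (Hd : 0 < d) by (unfold d; lra).
replace ((- b) ^ 2 + a * d) with (b ^ 2 + a * d) by ring.
assert (Hs : sqrt (b ^ 2 + a * d) ^ 2 = b ^ 2 + a * d)
  by (apply pow2_sqrt; nra).
set (s := sqrt _) in *.
transitivity ((s ^ 2 - b ^ 2) / a ^ 2); [field; lra | rewrite Hs; field; lra].
Qed.

Lemma exit_time_pos (c : point) (r : R) (P v : point) :
  0 < pdot v v -> pdot (psub P c) (psub P c) < r ^ 2 ->
  0 < exit_time c r P v.
Proof.
intros Hv HP; unfold exit_time.
set (a := pdot v v) in *; set (b := pdot (psub P c) v).
set (d := r ^ 2 - _).
assert (Had : 0 < a * d) by (apply Rmult_lt_0_compat; unfold d; lra).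
apply Rdiv_lt_0_compat; trivial.
assert (H : sqrt (b ^ 2) < sqrt (b ^ 2 + a * d)) by
  (apply sqrt_lt_1_alt; nra).
replace (b ^ 2) with (Rsqr b) in H at 1 by (unfold Rsqr; ring).
rewrite sqrt_Rsqr_abs in H; pose proof (Rle_abs b); lra.
Qed.

Lemma hdist_ray (c : point) (r : R) (P v : point) (t : R) :
  0 < pdot v v -> pdot (psub P c) (psub P c) < r ^ 2 ->
  0 < t < exit_time c r P v ->
  hdist c r P (padd P (pscal t v))
  = / 2 * (ln (1 + t / exit_time c r P (popp v))
           - ln (1 - t / exit_time c r P v)).
Proof.
intros Hv HP Ht; unfold hdist.
assert (Hv' : 0 < pdot (popp v) (popp v))
  by (unfold popp, pdot, pscal in *; simpl; lra).
pose proof (exit_time_pos c r P v Hv HP) as Hp.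
pose proof (exit_time_pos c r P (popp v) Hv' HP) as Hm.
rewrite exit_point_ray, exit_point_ray_back by lra.
set (p := exit_time c r P v) in *; set (m := exit_time c r P (popp v)) in *.
replace (edist (padd P (pscal p v)) P) with (p * sqrt (pdot v v)).
2:{ transitivity (edist (padd P (pscal p v)) (padd P (pscal 0 v))).
    - rewrite edist_line, Rminus_0_r, Rabs_pos_eq; lra.
    - f_equal; destruct P; unfold padd, pscal; simpl; f_equal; ring. }
replace (edist (padd P (pscal (- m) v)) P) with (m * sqrt (pdot v v)).
2:{ transitivity (edist (padd P (pscal (- m) v)) (padd P (pscal 0 v))).
    - rewrite edist_line, Rminus_0_r, Rabs_Ropp, Rabs_pos_eq; lra.
    - f_equal; destruct P; unfold padd, pscal; simpl; f_equal; ring. }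
rewrite !edist_line, (Rabs_pos_eq (p - t)) by lra.
rewrite (Rabs_left (- m - t)) by lra.
pose proof (sqrt_lt_R0 _ Hv) as Hs.
assert (H1 : 0 < 1 + t / m) by (pose proof (Rdiv_lt_0_compat t m); lra).
assert (H2 : 0 < 1 - t / p).
{ replace (1 - t / p) with ((p - t) / p) by (field; lra).
  apply Rdiv_lt_0_compat; lra. }
rewrite <- ln_div by assumption.
do 2 f_equal; field; lra.
Qed.

(** For negative [t] the ray runs along [-v], which exchanges the two logarithms; squaring removes
    the sign. *)
Lemma hdist_line_sqr (c : point) (r : R) (P v : point) (t : R) :
  0 < pdot v v -> pdot (psub P c) (psub P c) < r ^ 2 ->
  t <> 0 -> - exit_time c r P (popp v) < t < exit_time c r P v ->
  hdist c r P (padd P (pscal t v)) ^ 2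
  = (/ 2 * (ln (1 + t / exit_time c r P (popp v))
            - ln (1 - t / exit_time c r P v))) ^ 2.
Proof.
intros Hv HP H0 Ht; destruct (Rtotal_order t 0) as [H | [H | H]]; try lra.
- assert (Hv' : 0 < pdot (popp v) (popp v))
    by (unfold popp, pdot, pscal in *; simpl; lra).
  replace (pscal t v) with (pscal (- t) (popp v))
    by (unfold popp, pscal; simpl; f_equal; ring).
  rewrite hdist_ray by (trivial; lra).
  replace (popp (popp v)) with v
    by (destruct v; unfold popp, pscal; simpl; f_equal; ring).
  replace (1 - - t / exit_time c r P (popp v))
    with (1 + t / exit_time c r P (popp v)) by (unfold Rdiv; ring).
  replace (1 + - t / exit_time c r P v)
    with (1 - t / exit_time c r P v) by (unfold Rdiv; ring).
  ring.
- now rewrite hdist_ray by lra.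
Qed.

(** * The Riemannian metric in closed form *)

Lemma is_lim_slope (f : R -> R) (l : R) :
  f 0 = 0 -> is_derive f 0 l -> is_lim (fun t => f t / t) 0 l.
Proof.
intros Hf Hd; apply is_derive_Reals in Hd.
apply is_lim_spec; intros eps.
destruct (Hd eps (cond_pos eps)) as [delta Hdelta].
exists delta; intros y Hy H0.
specialize (Hdelta y H0).
rewrite Rplus_0_l, Hf, Rminus_0_r in Hdelta; apply Hdelta.
unfold ball in Hy; simpl in Hy; unfold AbsRing_ball, abs, minus, plus, opp in Hy.
simpl in Hy; replace y with (y + - 0) by ring; exact Hy.
Qed.

(** With exit times [p] along [v] and [m] along [-v], the signed distance has derivative
    [(1/m + 1/p) / 2] at 0. This depends only on the sum and the product of [p] and [m]. *)
Lemma hnorm2_klein (c : point) (r : R) (P v : point) :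
  pdot (psub P c) (psub P c) < r ^ 2 ->
  hnorm2 c r P v
  = (pdot (psub P c) v ^ 2 + pdot v v * (r ^ 2 - pdot (psub P c) (psub P c)))
    / (r ^ 2 - pdot (psub P c) (psub P c)) ^ 2.
Proof.
intros HP; unfold hnorm2.
(* For [v = 0] the exit times divide by zero, but the distance is constantly 0. *)
destruct (Req_dec (pdot v v) 0) as [H0 | H0].
- assert (v = (0, 0)) as ->.
  { destruct v as [x y]; unfold pdot in H0; simpl in H0; f_equal; nra. }
  rewrite (Lim_ext (fun _ => 0)).
  + rewrite Lim_const; unfold pdot; simpl; field.
    unfold pdot in HP; simpl in HP; lra.
  + intros t; symmetry; replace (padd P (pscal t (0, 0))) with P
      by (destruct P; unfold padd, pscal; simpl; f_equal; ring).
    rewrite hdist_refl; unfold Rdiv; ring.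
- assert (Hv : 0 < pdot v v) by (unfold pdot in *; nra).
  assert (Hv' : 0 < pdot (popp v) (popp v))
    by (unfold popp, pdot, pscal in *; simpl; lra).
  pose proof (exit_time_pos c r P v Hv HP) as Hp.
  pose proof (exit_time_pos c r P (popp v) Hv' HP) as Hm.
  pose proof (exit_time_mult c r P v Hv HP) as Hpm.
  assert (Hsum : exit_time c r P v + exit_time c r P (popp v)
    = 2 * sqrt (pdot (psub P c) v ^ 2
        + pdot v v * (r ^ 2 - pdot (psub P c) (psub P c))) / pdot v v).
  { unfold exit_time.
    replace (pdot (psub P c) (popp v)) with (- pdot (psub P c) v)
      by (unfold popp, pdot, pscal; simpl; ring).
    replace (pdot (popp v) (popp v)) with (pdot v v)
      by (unfold popp, pdot, pscal; simpl; ring).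
    replace ((- pdot (psub P c) v) ^ 2) with (pdot (psub P c) v ^ 2) by ring.
    field; lra. }
  assert (Hlim : is_lim (fun t => (hdist c r P (padd P (pscal t v)) / t) ^ 2) 0
    ((/ 2 * (/ exit_time c r P (popp v) + / exit_time c r P v)) ^ 2)).
  { set (p := exit_time c r P v) in *.
    set (m := exit_time c r P (popp v)) in *.
    set (g := fun t => / 2 * (ln (1 + t / m) - ln (1 - t / p))).
    apply (is_lim_ext_loc (fun t => (g t / t) ^ 2)).
    - assert (Hpos : 0 < Rmin p m) by (apply Rmin_pos; assumption).
      exists (mkposreal _ Hpos); intros t Ht Ht0.
      unfold ball in Ht; simpl in Ht.
      unfold AbsRing_ball, abs, minus, plus, opp in Ht; simpl in Ht.
      apply Rabs_def2 in Ht.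
      pose proof (Rmin_l p m); pose proof (Rmin_r p m).
      unfold Rdiv; rewrite !Rpow_mult_distr.
      rewrite hdist_line_sqr; trivial; fold p m; lra.
    - apply is_lim_comp_continuous with (g := fun x => x ^ 2).
      + apply is_lim_slope.
        * unfold g; unfold Rdiv; rewrite !Rmult_0_l, Rplus_0_r, Rminus_0_r; ring.
        * unfold g; auto_derive; [| field; lra].
          unfold Rdiv; rewrite !Rmult_0_l; lra.
      + apply (ex_derive_continuous (fun x : R => x ^ 2)); auto_derive; trivial. }
  rewrite (is_lim_unique _ _ _ Hlim); simpl real.
  set (p := exit_time c r P v) in *.
  set (m := exit_time c r P (popp v)) in *.
  set (d := r ^ 2 - pdot (psub P c) (psub P c)) in *.
  assert (Hd : 0 < d) by (unfold d; lra).
  replace (/ m + / p) with ((p + m) / (p * m)) by (field; lra).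
  rewrite Hsum, Hpm.
  set (S := sqrt _).
  assert (HS : S ^ 2 = pdot (psub P c) v ^ 2 + pdot v v * d)
    by (apply pow2_sqrt; nra).
  rewrite <- HS; field; lra.
Qed.

Lemma hinner_klein (c : point) (r : R) (P u v : point) :
  pdot (psub P c) (psub P c) < r ^ 2 ->
  hinner c r P u v
  = (pdot (psub P c) u * pdot (psub P c) v
     + pdot u v * (r ^ 2 - pdot (psub P c) (psub P c)))
    / (r ^ 2 - pdot (psub P c) (psub P c)) ^ 2.
Proof.
intros HP; unfold hinner; rewrite !hnorm2_klein by exact HP.
set (d := r ^ 2 - _).
assert (Hd : d <> 0) by (unfold d; lra); clearbody d.
set (w := psub P c); unfold pdot, padd, psub; simpl; field; exact Hd.
Qed.

(** * Homogeneous coordinates, lines and convexity of the disk *)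

(* The homogeneous coordinates [(r : X : Y)] of a point are read as the
   symmetric matrix [[r + X, Y], [Y, r - X]].  The ideal points are then the
   matrices of rank one, and the point at angle [t] is a multiple of
   [sym (half t) (half t)]. *)
Definition hom (c : point) (r : R) (Z : point) : vec :=
  let X := fst (psub Z c) in let Y := snd (psub Z c) in
  (r + X, 2 * Y, r - X).

Definition line_form (c : point) (r : R) (l : point -> Prop) (L : vec) : Prop :=
  L <> (0, 0, 0) /\ forall Z, l Z <-> in_disk c r Z /\ vdot (hom c r Z) L = 0.

Definition plerp (s : R) (P Q : point) : point := padd P (pscal s (psub Q P)).

Lemma vdot_hom_plerp (c : point) (r s : R) (P Q : point) (L : vec) :
  vdot (hom c r (plerp s P Q)) L
  = (1 - s) * vdot (hom c r P) L + s * vdot (hom c r Q) L.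
Proof.
destruct L as [[? ?] ?], P, Q, c.
unfold vdot, hom, plerp, padd, psub, pscal; simpl; ring.
Qed.

Lemma hline_form (c : point) (r : R) (l : point -> Prop) :
  0 < r -> hline c r l -> exists L, line_form c r l L.
Proof.
intros Hr [_ [P [Q [HPQ Hl]]]].
exists (cross (hom c r P) (hom c r Q)); split.
- intros H; apply HPQ; destruct P as [x y], Q as [x' y'], c as [c1 c2].
  unfold cross, hom, psub in H; simpl in H.
  injection H as H1 H2 H3.
  assert (Hx : x = x') by (apply (Rmult_eq_reg_l (2 * r)); lra).
  subst x'; f_equal; apply (Rmult_eq_reg_l (4 * r)); lra.
- intros Z; rewrite Hl; unfold chord.
  destruct P as [x y], Q as [x' y'], c as [c1 c2], Z as [z1 z2].
  unfold vdot, cross, hom, padd, pscal, psub; simpl.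
  split; intros [HZ H]; split; trivial.
  + destruct H as [t H]; injection H as -> ->; ring.
  + assert (H' : (x' - x) * (z2 - y) = (y' - y) * (z1 - x)) by
      (apply (Rmult_eq_reg_l (4 * r)); lra).
    (* The parameter on the chord is read off a coordinate in which [P] and [Q] differ. *)
    clear H; destruct (Req_dec (x' - x) 0) as [Hx | Hx].
    * destruct (Req_dec (y' - y) 0) as [Hy | Hy].
      { destruct HPQ; f_equal; lra. }
      exists ((z2 - y) / (y' - y)).
      rewrite Hx, Rmult_0_l in H'; symmetry in H'.
      apply Rmult_integral in H'.
      f_equal; [rewrite Hx; lra | field; exact Hy].
    * exists ((z1 - x) / (x' - x)).
      f_equal; [field; exact Hx |].
      apply (Rmult_eq_reg_l (x' - x)); trivial.
      replace ((x' - x) * (y + (z1 - x) / (x' - x) * (y' - y)))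
        with ((x' - x) * y + (y' - y) * (z1 - x)) by (field; exact Hx).
      rewrite <- H'; ring.
Qed.

(** Supplies points other than the foot on both lines, at which the orthogonality condition can be
    evaluated. For [s <= 1] the squared norm grows by at most [s (2 |b| + a)], which is below [d]
    when [s = d / k]. *)
Lemma in_disk_near (c : point) (r : R) (P v : point) :
  0 < r -> in_disk c r P ->
  exists s, 0 < s /\ in_disk c r (padd P (pscal s v)).
Proof.
intros Hr; rewrite in_disk_iff by exact Hr; intros HP.
set (b := pdot (psub P c) v); set (a := pdot v v).
set (d := r ^ 2 - pdot (psub P c) (psub P c)).
assert (Hd : 0 < d) by (unfold d; lra).
assert (Ha : 0 <= a) by (unfold a, pdot; nra).
pose proof (Rabs_pos b) as Hb0; pose proof (Rle_abs b) as Hb.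
set (k := d + 2 * Rabs b + a + 1).
assert (Hk : 0 < k) by (unfold k; lra).
assert (Hs : 0 < d / k) by (apply Rdiv_lt_0_compat; trivial).
assert (Hsk : d / k * k = d) by (field; lra).
exists (d / k); split; trivial.
rewrite in_disk_iff by exact Hr.
set (s := d / k) in *.
replace (pdot _ _)
  with (pdot (psub P c) (psub P c) + (2 * s * b + s ^ 2 * a))
  by (unfold a, b, pdot, padd, psub, pscal; simpl; ring).
assert (Hs1 : s <= 1).
{ apply Rmult_le_reg_r with k; trivial; rewrite Hsk; unfold k; lra. }
assert (2 * s * b + s ^ 2 * a < d).
{ assert (s * b <= s * Rabs b) by (apply Rmult_le_compat_l; lra).
  assert (s * a * s <= s * a * 1)
    by (apply Rmult_le_compat_l; [apply Rmult_le_pos |]; lra).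
  unfold k in Hsk; clearbody s; nra. }
unfold d in *; lra.
Qed.

Lemma in_disk_plerp (c : point) (r s : R) (P Q : point) :
  0 < r -> 0 <= s <= 1 -> in_disk c r P -> in_disk c r Q ->
  in_disk c r (plerp s P Q).
Proof.
intros Hr Hs; rewrite !in_disk_iff by exact Hr; intros HP HQ.
replace (pdot (psub (plerp s P Q) c) (psub (plerp s P Q) c))
  with ((1 - s) * pdot (psub P c) (psub P c) + s * pdot (psub Q c) (psub Q c)
        - s * (1 - s) * pdot (psub Q P) (psub Q P))
  by (unfold plerp, pdot, padd, psub, pscal; simpl; ring).
assert (0 <= pdot (psub Q P) (psub Q P)) by (unfold pdot; nra).
assert (0 <= s * (1 - s)) by nra.
assert (0 <= s * (1 - s) * pdot (psub Q P) (psub Q P))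
  by (apply Rmult_le_pos; assumption).
destruct (Req_dec s 0) as [-> | Hs0]; [lra | nra].
Qed.

(** * Half-angle vectors, poles and orthogonality *)

Definition half (t : R) : R * R := (cos (t / 2), sin (t / 2)).

Lemma circle_point_mid (c : point) (r h k : R) :
  circle_point c r (h + k)
  = padd c (pscal r (cos h * cos k - sin h * sin k,
                     sin h * cos k + cos h * sin k)).
Proof. unfold circle_point; now rewrite cos_plus, sin_plus. Qed.

(* With [h] the mean and [k] half the difference of the two angles, the pole of
   the chord lies in direction [(cos h, sin h)] at distance [r / cos k]. *)
Lemma sym_half (a b : R) :
  let h := (a + b) / 2 in let k := (b - a) / 2 in
  sym (half a) (half b) = ((cos k + cos h) / 2, sin h, (cos k - cos h) / 2).
Proof.
intros h k.
replace h with (a / 2 + b / 2) by (unfold h; field).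
replace k with (b / 2 - a / 2) by (unfold k; field).
rewrite cos_plus, sin_plus, cos_minus; unfold sym, half; simpl.
f_equal; [f_equal |]; field.
Qed.

Lemma unit_interval (s : R) : 0 < s * (1 - s) -> 0 < s < 1.
Proof. intros H; nra. Qed.

(** The metric pairing of the directions of [l] and of the chord is, modulo incidence of the foot
    with [l], a nonzero multiple of the pairing of [L] with the pole. The foot lies in the open
    disk, hence strictly between the endpoints. *)
Lemma horthogonal_pole (c : point) (r a b : R) (l : point -> Prop) (L : vec) :
  0 < r -> sin ((b - a) / 2) <> 0 -> line_form c r l L ->
  horthogonal c r l (chord c r (circle_point c r a) (circle_point c r b)) ->
  vdot L (sym (half a) (half b)) = 0 /\
  exists s, 0 < s < 1 /\
    l (plerp s (circle_point c r a) (circle_point c r b)).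
Proof.
intros Hr Hk [_ Hl] [P [HlP [[HP [s HPs]] Horth]]].
fold (plerp s (circle_point c r a) (circle_point c r b)) in HPs.
set (h := (a + b) / 2); set (k := (b - a) / 2) in *.
assert (HA : circle_point c r a = padd c (pscal r
  (cos h * cos k + sin h * sin k, sin h * cos k - cos h * sin k))).
{ replace a with (h + - k) by (unfold h, k; field).
  rewrite circle_point_mid, cos_neg, sin_neg.
  f_equal; f_equal; f_equal; ring. }
assert (HB : circle_point c r b = padd c (pscal r
  (cos h * cos k - sin h * sin k, sin h * cos k + cos h * sin k))).
{ rewrite <- circle_point_mid; f_equal; unfold h, k; field. }
assert (Hh2 : sin h ^ 2 = 1 - cos h ^ 2).
{ pose proof (sin2_cos2 h); unfold Rsqr in *; lra. }
assert (Hk2 : sin k ^ 2 = 1 - cos k ^ 2).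
{ pose proof (sin2_cos2 k); unfold Rsqr in *; lra. }
(* The power of the foot is the product of the two segments of a chord of length [2 r |sin k|]. *)
assert (Hd : r ^ 2 - pdot (psub P c) (psub P c)
  = r ^ 2 * sin k ^ 2 * (4 * (s * (1 - s)))).
{ rewrite HPs, HA, HB; unfold pdot, plerp, padd, psub, pscal; simpl.
  ring [Hh2 Hk2]. }
assert (HPd := HP); rewrite in_disk_iff in HPd by exact Hr.
assert (Hr2 : 0 < r ^ 2 * sin k ^ 2)
  by (apply Rmult_lt_0_compat; [apply pow_lt | apply pow2_gt_0]; assumption).
assert (Hs : 0 < s * (1 - s)).
{ apply Rmult_lt_reg_l with (r ^ 2 * sin k ^ 2); trivial; lra. }
split.
2:{ exists s; split; [now apply unit_interval | rewrite <- HPs; exact HlP]. }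
destruct L as [[L1 L2] L3].
(* In affine coordinates [L] has normal [(L1 - L3, 2 L2)], so [u] is a direction of [l]. *)
set (u := (- 2 * L2, L1 - L3)).
set (v := psub (circle_point c r b) (circle_point c r a)).
destruct (in_disk_near c r P u Hr HP) as [i [Hi HX]].
destruct (in_disk_near c r P v Hr HP) as [j [Hj HY]].
apply Hl in HlP; destruct HlP as [_ HLP].
specialize (Horth (padd P (pscal i u)) (padd P (pscal j v))).
rewrite hinner_klein in Horth by exact HPd.
assert (E : pdot (psub P c) u * pdot (psub P c) v
  + pdot u v * (r ^ 2 - pdot (psub P c) (psub P c)) = 0).
{ apply (Rmult_eq_reg_l
    (i * j / (r ^ 2 - pdot (psub P c) (psub P c)) ^ 2)).
  2:{ apply Rgt_not_eq, Rdiv_lt_0_compat;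
      [apply Rmult_lt_0_compat | apply pow_lt]; lra. }
  rewrite Rmult_0_r; rewrite <- Horth.
  - replace (psub (padd P (pscal i u)) P) with (pscal i u)
      by (destruct P; unfold psub, padd, pscal; simpl; f_equal; ring).
    replace (psub (padd P (pscal j v)) P) with (pscal j v)
      by (destruct P; unfold psub, padd, pscal; simpl; f_equal; ring).
    assert (Hd0 : r ^ 2 - pdot (psub P c) (psub P c) <> 0) by lra.
    set (d := r ^ 2 - pdot (psub P c) (psub P c)) in *; set (w := psub P c).
    clearbody d; unfold pdot, pscal; simpl; field; exact Hd0.
  - apply Hl; split; trivial; rewrite <- HLP.
    unfold vdot, hom, u, padd, pscal, psub; simpl; ring.
  - split; trivial; exists (s + j); rewrite HPs; unfold v, plerp.
    unfold padd, pscal, psub; simpl; f_equal; ring. }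
clear Horth HX HY; unfold v in E; rewrite Hd in E; clear v Hd HPd.
rewrite HPs in HLP, E; rewrite HA, HB in HLP, E; clear HA HB HPs.
rewrite sym_half; fold h k.
apply (Rmult_eq_reg_l (4 * r ^ 3 * sin k)).
2:{ pose proof (pow_lt r 3 Hr); apply Rmult_integral_contrapositive; lra. }
rewrite Rmult_0_r, <- E.
(* The left side of [E] is [4 r^3 sin k] times the pairing with the pole minus [2 r^2 sin k cos k]
   times the incidence [HLP]. *)
match goal with |- ?x = _ =>
  transitivity (x - 2 * r ^ 2 * sin k * cos k * 0); [ring |] end.
rewrite <- HLP.
unfold plerp, vdot, hom, u, pdot, padd, pscal, psub; simpl.
field [Hh2 Hk2].
Qed.

(** * Orientation and separation of points by a line *)

Definition orient (P Q S : point) : R :=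
  bracket (psub Q P) (psub S P).

Lemma orient_rot (P Q S : point) : orient P Q S = orient Q S P.
Proof. unfold orient, bracket, psub; simpl; ring. Qed.

(** Twice the signed area of an inscribed triangle is the product of its sides over [2 r], and each
    side is [2 r] times a half-angle sine. *)
Lemma orient_circle_point (c : point) (r a b d : R) :
  orient (circle_point c r a) (circle_point c r b) (circle_point c r d)
  = 4 * r ^ 2 * (bracket (half a) (half b) * bracket (half b) (half d)
                 * bracket (half a) (half d)).
Proof.
assert (H : forall t, circle_point c r t = padd c (pscal r
  (cos (t / 2) ^ 2 - sin (t / 2) ^ 2, 2 * sin (t / 2) * cos (t / 2)))).
{ intros t; replace t with (t / 2 + t / 2) at 1 by field.
  rewrite circle_point_mid; f_equal; f_equal; f_equal; ring. }
rewrite !H.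
assert (Ha : cos (a / 2) ^ 2 = 1 - sin (a / 2) ^ 2)
  by (pose proof (sin2_cos2 (a / 2)); unfold Rsqr in *; lra).
assert (Hb : cos (b / 2) ^ 2 = 1 - sin (b / 2) ^ 2)
  by (pose proof (sin2_cos2 (b / 2)); unfold Rsqr in *; lra).
assert (Hd : cos (d / 2) ^ 2 = 1 - sin (d / 2) ^ 2)
  by (pose proof (sin2_cos2 (d / 2)); unfold Rsqr in *; lra).
unfold orient, bracket, half, psub, padd, pscal; simpl.
ring [Ha Hb Hd].
Qed.

(** Makes the bracket positive whenever [b] follows [a] within one full turn. *)
Lemma bracket_half (a b : R) : bracket (half a) (half b) = sin ((b - a) / 2).
Proof.
replace ((b - a) / 2) with (b / 2 - a / 2) by field.
rewrite sin_minus; unfold bracket, half; simpl; ring.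
Qed.

(** [orient] is affine in each argument; in the expansion the terms with [B] twice vanish and all
    others are positive. *)
Lemma orient_plerp_pos (A B C D E : point) (s t u : R) :
  0 < s < 1 -> 0 < t < 1 -> 0 < u < 1 ->
  0 < orient A B D -> 0 < orient A B E -> 0 < orient A C D ->
  0 < orient A C E -> 0 < orient B C D -> 0 < orient B C E ->
  0 < orient (plerp s A B) (plerp t B C) (plerp u D E).
Proof.
intros Hs Ht Hu H1 H2 H3 H4 H5 H6.
replace (orient (plerp s A B) (plerp t B C) (plerp u D E)) with
  ((1 - s) * (1 - t) * ((1 - u) * orient A B D + u * orient A B E)
   + (1 - s) * t * ((1 - u) * orient A C D + u * orient A C E)
   + s * t * ((1 - u) * orient B C D + u * orient B C E))
  by (unfold orient, bracket, plerp, psub, padd, pscal; simpl; ring).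
repeat apply Rplus_lt_0_compat; repeat apply Rmult_lt_0_compat; try lra;
  apply Rplus_lt_0_compat; apply Rmult_lt_0_compat; lra.
Qed.

(* The four points P1, P2, Q1, Q2 satisfy the linear relation
   [P1] [P2 Q1 Q2] - [P2] [P1 Q1 Q2] + [Q1] [P1 P2 Q2] - [Q2] [P1 P2 Q1] = 0. *)
Lemma line_separates (c : point) (r : R) (L : vec) (P1 P2 Q1 Q2 : point) :
  0 < r -> L <> (0, 0, 0) ->
  vdot (hom c r P1) L = 0 -> vdot (hom c r Q1) L = 0 ->
  0 < orient P1 P2 Q1 -> 0 < orient P1 Q1 Q2 ->
  vdot (hom c r P2) L * vdot (hom c r Q2) L < 0.
Proof.
intros Hr HL HP1 HQ1 H1 H2.
assert (E : vdot (hom c r P2) L * orient P1 Q1 Q2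
  = - (vdot (hom c r Q2) L * orient P1 P2 Q1)).
{ transitivity (- (vdot (hom c r Q2) L * orient P1 P2 Q1)
    + vdot (hom c r P1) L * orient P2 Q1 Q2
    + vdot (hom c r Q1) L * orient P1 P2 Q2);
  [| rewrite HP1, HQ1; ring].
  destruct L as [[? ?] ?].
  unfold vdot, hom, orient, bracket, psub; simpl; ring. }
(* Otherwise [L] would vanish at three non-collinear points; [E1] and [E2] are Cramer's rule for its
   linear part, after which only the constant [2 r L3] remains. *)
assert (H0 : vdot (hom c r P2) L <> 0).
{ intros HP2; apply HL; clear E; destruct L as [[L1 L2] L3].
  assert (E1 : (L1 - L3) * orient P1 P2 Q1
    = vdot (hom c r P1) (L1, L2, L3) * (snd P2 - snd Q1)
      + vdot (hom c r P2) (L1, L2, L3) * (snd Q1 - snd P1)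
      + vdot (hom c r Q1) (L1, L2, L3) * (snd P1 - snd P2))
    by (unfold vdot, hom, orient, bracket, psub; simpl; ring).
  assert (E2 : 2 * L2 * orient P1 P2 Q1
    = vdot (hom c r P1) (L1, L2, L3) * (fst Q1 - fst P2)
      + vdot (hom c r P2) (L1, L2, L3) * (fst P1 - fst Q1)
      + vdot (hom c r Q1) (L1, L2, L3) * (fst P2 - fst P1))
    by (unfold vdot, hom, orient, bracket, psub; simpl; ring).
  rewrite HP1, HP2, HQ1, !Rmult_0_l, !Rplus_0_l in E1, E2.
  apply Rmult_integral in E1, E2.
  assert (E3 : L1 = L3) by lra.
  assert (E4 : L2 = 0) by lra.
  subst; unfold vdot, hom in HP1; simpl in HP1.
  assert (L3 = 0) by (apply (Rmult_eq_reg_l (2 * r)); lra).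
  subst; reflexivity. }
set (x := vdot (hom c r P2) L) in *; set (y := vdot (hom c r Q2) L) in *.
set (p := orient P1 P2 Q1) in *; set (q := orient P1 Q1 Q2) in *.
clearbody x y p q.
apply Rmult_lt_reg_r with p; trivial.
replace (x * y * p) with (- (x * x) * q) by (rewrite Ropp_mult_distr_l_reverse;
  replace (x * y * p) with (x * (y * p)) by ring; nra).
assert (0 < x * x) by nra; nra.
Qed.

(** * Concurrency for the counterclockwise order *)

Lemma proposition2_counterclockwise (c : point) (r : R) (A B C D E F : point)
    (l1 l2 l3 : point -> Prop) :
  0 < r ->
  counterclockwise c r A B C D E F ->
  common_perpendicular c r (chord c r A B) (chord c r D E) l1 ->
  common_perpendicular c r (chord c r B C) (chord c r E F) l2 ->
  common_perpendicular c r (chord c r C D) (chord c r F A) l3 ->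
  exists P : point, in_disk c r P /\ l1 P /\ l2 P /\ l3 P.
Proof.
intros Hr (ta & tb & tc & td & te & tf & Hord & -> & -> & -> & -> & -> & ->).
intros [h1 [o1 o1']] [h2 [o2 o2']] [h3 [o3 o3']].
destruct (hline_form c r l1 Hr h1) as [L1 F1].
destruct (hline_form c r l2 Hr h2) as [L2 F2].
destruct (hline_form c r l3 Hr h3) as [L3 F3].
assert (pos : forall x y, x < y < x + 2 * PI ->
    0 < bracket (half x) (half y)).
{ intros x y H; rewrite bracket_half; apply sin_gt_0; lra. }
assert (opos : forall x y z, x < y < z -> z < x + 2 * PI ->
  0 < orient (circle_point c r x) (circle_point c r y) (circle_point c r z)).
{ intros x y z H H'; rewrite orient_circle_point.
  repeat apply Rmult_lt_0_compat; try apply pos; try lra; nra. }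
assert (neq : forall x y, x < y < x + 2 * PI -> sin ((y - x) / 2) <> 0).
{ intros x y H; apply Rgt_not_eq, sin_gt_0; lra. }
(* On the closing side [FA] the angle decreases and the sine is negative, but only its being nonzero
   matters. *)
assert (neq' : sin ((ta - tf) / 2) <> 0).
{ replace ((ta - tf) / 2) with (- ((tf - ta) / 2)) by field.
  rewrite sin_neg; apply Ropp_neq_0_compat, neq; lra. }
destruct (horthogonal_pole c r ta tb l1 L1) as [n1 [s1 [Hs1 p1]]]; trivial;
  [apply neq; lra |].
destruct (horthogonal_pole c r td te l1 L1) as [n1' [t1 [Ht1 q1]]]; trivial;
  [apply neq; lra |].
destruct (horthogonal_pole c r tb tc l2 L2) as [n2 [s2 [Hs2 p2]]]; trivial;
  [apply neq; lra |].
destruct (horthogonal_pole c r te tf l2 L2) as [n2' [t2 [Ht2 q2]]]; trivial;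
  [apply neq; lra |].
destruct (horthogonal_pole c r tc td l3 L3) as [n3 _]; trivial;
  [apply neq; lra |].
destruct (horthogonal_pole c r tf ta l3 L3) as [n3' _]; trivial.
destruct F1 as [N1 F1], F2 as [N2 F2], F3 as [_ F3].
apply F1 in p1, q1; apply F2 in p2, q2.
destruct p1 as [_ p1], q1 as [_ q1], p2 as [d2 p2], q2 as [e2 q2].
set (P2 := plerp s2 _ _) in *; set (Q2 := plerp t2 _ _) in *.
(* The feet on [AB], [BC], [DE], [EF] inherit the cyclic order of the sides, so the line through the
   first and third separates the other two. *)
assert (Hsep : vdot (hom c r P2) L1 * vdot (hom c r Q2) L1 < 0).
{ apply (line_separates c r L1 _ _ _ _ Hr N1 p1 q1).
  - apply orient_plerp_pos; trivial; apply opos; lra.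
  - rewrite orient_rot.
    apply orient_plerp_pos; trivial; rewrite <- orient_rot; apply opos; lra. }
(* If the lines coincided, [P2] would lie on [l1]. *)
assert (Hcross : cross L1 L2 <> (0, 0, 0)).
{ intros H; rewrite (cross_eq0_vdot _ _ _ H N2 p2) in Hsep; lra. }
set (x := vdot (hom c r P2) L1) in *; set (y := vdot (hom c r Q2) L1) in *.
assert (Hxy : x - y <> 0) by nra.
assert (Hth : 0 <= x / (x - y) <= 1).
{ assert (E : x / (x - y) * (x - y) = x) by (field; exact Hxy).
  set (th := x / (x - y)) in *; clearbody th x y.
  destruct (Rlt_le_dec 0 x); [assert (y < 0) by nra | assert (0 < y) by nra];
    split; nra. }
(* The form [L1] is affine on the segment from [P2] to [Q2], with end values [x] and [y]; this is
   its zero. *)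
set (Z := plerp (x / (x - y)) P2 Q2).
assert (HZ : in_disk c r Z) by (apply in_disk_plerp; assumption).
assert (Z1 : vdot (hom c r Z) L1 = 0).
{ unfold Z; rewrite vdot_hom_plerp; fold x y; field; exact Hxy. }
assert (Z2 : vdot (hom c r Z) L2 = 0).
{ unfold Z; rewrite vdot_hom_plerp, p2, q2; ring. }
exists Z; rewrite F1, F2, F3; repeat split; trivial.
apply (hexagon_concurrent (half ta) (half tb) (half tc)
  (half td) (half te) (half tf) L1 L2); trivial; apply pos; lra.
Qed.

(** * Reduction of the clockwise order to the counterclockwise one *)

Lemma chord_sym (c : point) (r : R) (P Q Z : point) :
  chord c r P Q Z -> chord c r Q P Z.
Proof.
intros [HZ [t ->]]; split; trivial.
exists (1 - t); unfold padd, pscal, psub; simpl; f_equal; ring.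
Qed.

Lemma horthogonal_chord_sym (c : point) (r : R) (P Q : point)
    (l : point -> Prop) :
  horthogonal c r l (chord c r P Q) -> horthogonal c r l (chord c r Q P).
Proof.
intros [X [HX [HX' H]]]; exists X; split; [exact HX | split].
- apply chord_sym; exact HX'.
- intros Y Y' HY HY'; apply H; trivial; apply chord_sym; exact HY'.
Qed.

Lemma common_perpendicular_reverse (c : point) (r : R) (P Q P' Q' : point)
    (l : point -> Prop) :
  common_perpendicular c r (chord c r P Q) (chord c r P' Q') l ->
  common_perpendicular c r (chord c r Q' P') (chord c r Q P) l.
Proof. intros [H [H1 H2]]; split; [exact H |].
split; now apply horthogonal_chord_sym.
Qed.

Theorem proposition2 :
  forall (c : point) (r : R) (A B C D E F : point)
         (l1 l2 l3 : point -> Prop),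
    0 < r ->
    ideal_hexagon c r A B C D E F ->
    common_perpendicular c r (chord c r A B) (chord c r D E) l1 ->
    common_perpendicular c r (chord c r B C) (chord c r E F) l2 ->
    common_perpendicular c r (chord c r C D) (chord c r F A) l3 ->
    exists P : point, in_disk c r P /\ l1 P /\ l2 P /\ l3 P.
Proof.
intros c r A B C D E F l1 l2 l3 Hr [H | H] H1 H2 H3.
- now apply (proposition2_counterclockwise c r A B C D E F).
(* Reading the hexagon backwards exchanges [l1] and [l2]. For [l3] the two chords keep their places
   and only their endpoints are swapped. *)
- apply common_perpendicular_reverse in H1, H2.
  destruct (proposition2_counterclockwise c r F E D C B A l2 l1 l3)
    as [P HP]; trivial.
  + destruct H3 as [H3 [? ?]]; split; [exact H3 |].
    split; now apply horthogonal_chord_sym.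
  + exists P; tauto.
Qed.
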